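(* The schema $\bigcirc(B\mid A)\land\Diamond A\rightarrow\Diamond B$ is not valid in the class of CJ-models: there exist a CJ-model $M=\langle W,\mathrm{av},\mathrm{pv},\mathrm{ob},V\rangle$, propositional atoms $A,B$ and a world $w\in W$ such that $w\models\bigcirc(B\mid A)$ and $w\models\Diamond A$ but $w\not\models\Diamond B$.
   Context: A CJ-model is a tuple $M=\langle W,\mathrm{av},\mathrm{pv},\mathrm{ob},V\rangle$ where $W\neq\emptyset$; $V$ is a valuation assigning to each propositional atom a subset of $W$, extended to all formulas in the usual way, and $\|A\|=\{x\in W: x\models A\}$ denotes the truth set of $A$; $\mathrm{av},\mathrm{pv}:W\to\mathcal P(W)$ with $w\in\mathrm{av}(w)\subseteq\mathrm{pv}(w)$ for all $w\in W$; and $\mathrm{ob}:\mathcal P(W)\to\mathcal P(\mathcal P(W))$ satisfies, for all $X,Y,Z\subseteq W$: (1) $\emptyset\notin\mathrm{ob}(X)$; (2) if $Y\cap X=Z\cap X$ then ($Y\in\mathrm{ob}(X)\iff Z\in\mathrm{ob}(X)$); (3) if $Y\in\mathrm{ob}(X)$ and $Z\in\mathrm{ob}(X)$ then $Y\cap Z\in\mathrm{ob}(X)$; (4) if $X\subseteq Y\subseteq Z$ and $X\in\mathrm{ob}(Y)$ then $(Z\setminus Y)\cup X\in\mathrm{ob}(Z)$. Truth conditions: $w\models\Box A$ iff $\mathrm{pv}(w)\subseteq\|A\|$; $\Diamond A$ abbreviates $\neg\Box\neg A$, so $w\models\Diamond A$ iff $\mathrm{pv}(w)\cap\|A\|\neq\emptyset$;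 $w\models\bigcirc(B\mid A)$ iff $\|B\|\cap\|A\|\neq\emptyset$ and for every $X\subseteq\|A\|$ with $X\cap\|B\|\neq\emptyset$ we have $\|B\|\in\mathrm{ob}(X)$. *)

(* Defs.v *)
From mathcomp Require Import all_boot.
From mathcomp Require Import boolp classical_sets.

Set Implicit Arguments.
Unset Strict Implicit.
Unset Printing Implicit Defensive.

Local Open Scope classical_set_scope.

(* [Ob B A] is the conditional obligation O(B | A): A is the condition. *)
Inductive form : Type :=
| Atom of nat
| Neg of form
| And of form & form
| Box of form
| Ob of form & form.

Definition Imp (A B : form) : form := Neg (And A (Neg B)).
Definition Dia (A : form) : form := Neg (Box (Neg A)).

Record cj_model : Type := CJModel {
  world : Type;
  av : world -> set world;
  pv : world -> set world;
  ob : set world -> set (set world);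
  valuation : nat -> set world;
  world_inhabited : inhabited world;
  av_refl : forall w, av w w;
  av_sub_pv : forall w, av w `<=` pv w;
  ob_set0 : forall X, ~ ob X set0;
  ob_ext : forall X Y Z, Y `&` X = Z `&` X -> (ob X Y <-> ob X Z);
  ob_setI : forall X Y Z, ob X Y -> ob X Z -> ob X (Y `&` Z);
  ob_up : forall X Y Z, X `<=` Y -> Y `<=` Z ->
    ob Y X -> ob Z ((Z `\` Y) `|` X)
}.

Fixpoint truth_set (M : cj_model) (A : form) : set (world M) :=
  match A with
  | Atom p => valuation p
  | Neg B => ~` @truth_set M B
  | And B C => @truth_set M B `&` @truth_set M C
  | Box B => [set w | pv w `<=` @truth_set M B]
  | Ob B C =>
      [set _ | @truth_set M B `&` @truth_set M C !=set0 /\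
        forall X : set (world M), X `<=` @truth_set M C ->
          X `&` @truth_set M B !=set0 -> ob X (@truth_set M B)]
  end.

Definition sat (M : cj_model) (w : world M) (A : form) : Prop :=
  truth_set A w.

Definition valid (A : form) : Prop :=
  forall (M : cj_model) (w : world M), sat w A.

(* Main.v *)
Require Import Defs.
From mathcomp Require Import all_boot.
From mathcomp Require Import boolp classical_sets.

Local Open Scope classical_set_scope.

(** No frame condition ties [ob] to [pv]. Let each world see only itself, with A true everywhere and
    B only at [true]: then B is obligatory given A, yet [false] sees no B-world. *)

(* Obligations may refer to worlds that are not potentially accessible: a set is
   obligatory in a context as soon as both contain the ideal world [true], which
   [false] does not see. *)
Definition ideal_world_model : cj_model.
Proof.
refine (@CJModel bool (fun w => [set w]) (fun w => [set w])
  (fun X => [set Y | X true /\ Y true])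
  (fun p => if p is 0 then setT else [set true])
  (inhabits true) _ _ _ _ _ _) => //=.
- by move=> w x.
- by move=> X [_ []].
- move=> X Y Z YZ; have YZt : (Y `&` X) true = (Z `&` X) true by rewrite YZ.
  split=> -[Xt Ht]; split=> //.
    by have [] : (Z `&` X) true by rewrite -YZt; split.
  by have [] : (Y `&` X) true by rewrite YZt; split.
- by move=> X Y Z [Xt Yt] [_ Zt].
- by move=> X Y Z _ YZ [Yt Xt]; split; [exact: YZ | right].
Defined.

Theorem mainTheorem1 :
  ~ (forall A B : form, valid (Imp (And (Ob B A) (Dia A)) (Dia B))) /\
  exists (M : cj_model) (a b : nat) (w : world M),
    sat w (Ob (Atom b) (Atom a)) /\ sat w (Dia (Atom a)) /\
    ~ sat w (Dia (Atom b)).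
Proof.
have [M [a [b [w [ObBA [DiaA nDiaB]]]]]] :
  exists (M : cj_model) (a b : nat) (w : world M),
    sat w (Ob (Atom b) (Atom a)) /\ sat w (Dia (Atom a)) /\
    ~ sat w (Dia (Atom b)).
  exists ideal_world_model, 0, 1, false; split; [|split].
  - split; first by exists true.
    (* A context meeting the truth set of B contains [true], which is all that [ob] demands. *)
    by move=> X _ [x [Xx /= xE]]; split=> //; rewrite -xE.
  - by move=> /(_ false erefl); apply.
  - by apply=> x /= ->.
split; last by exists M, a, b, w.
(* [Imp] unfolds to a negated conjunction, which the countermodel satisfies. *)
by move=> /(_ (Atom a) (Atom b) M w); apply; split.
Qed.
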